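(* Let $(\overline{x},\overline{\lambda})$ be a KKT point of the unperturbed problem, i.e. $(\overline{x},\overline{\lambda})\in\mathcal{S}_{\rm KKT}(0,0)$. Then the following two statements are equivalent. (i) (Error bound for the KKT system) There exist $\varepsilon>0$ and a constant $c>0$ such that for all $(x,\lambda)\in\mathbb{B}_{\varepsilon}((\overline{x},\overline{\lambda}))$, $$\|x-\overline{x}\|+{\rm dist}(\lambda,\mathcal{M}(\overline{x},0,0))\le c\left\|\begin{pmatrix}\nabla_xL(x,\lambda)\\ g(x)-\Pi_{\mathcal{K}}(\lambda+g(x))\end{pmatrix}\right\|.$$ (ii) $\mathcal{S}_{\rm KKT}$ has the strong calmness at the origin for $(\overline{x},\overline{\lambda})$.
   Context: Setting. $\mathbb{X},\mathbb{Y}$ are finite dimensional real vector spaces with inner product $\langle\cdot,\cdot\rangle$ and induced norm $\|\cdot\|$; $f:\mathbb{X}\to\mathbb{R}$ and $g:\mathbb{X}\to\mathbb{Y}$ are twice continuously differentiable; $\mathcal{K}\subseteq\mathbb{Y}$ is a nonempty closed convex set which is $C^2$-cone reducible: at every $\overline{y}\in\mathcal{K}$ there exist an open neighborhood $\mathcal{Y}$ of $\overline{y}$, a pointed closed convex cone $D$ in a finite dimensional space $\mathbb{Z}$, and a twice continuously differentiable $\Xi:\mathcal{Y}\to\mathbb{Z}$ with $\Xi(\overline{y})=0$, $\Xi'(\overline{y}):\mathbb{Y}\to\mathbb{Z}$ onto, and $\mathcal{K}\cap\mathcal{Y}=\{y\in\mathcal{Y}\mid\Xi(y)\in D\}$.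 The perturbed problem with parameter $(a,b)\in\mathbb{X}\times\mathbb{Y}$ is $\min_{x\in\mathbb{X}}\{f(x)-\langle a,x\rangle : g(x)-b\in\mathcal{K}\}$; the unperturbed problem has $(a,b)=(0,0)$. Notation. $h'(x)$ is the derivative of $h$ at $x$ and $\nabla h(x)$ its adjoint. $L(x,\lambda):=f(x)+\langle\lambda,g(x)\rangle$, so $\nabla_xL(x,\lambda)=\nabla f(x)+\nabla g(x)\lambda$. $\mathcal{N}_{\mathcal{K}}$ is the normal cone of convex analysis, $\Pi_{\mathcal{K}}$ the projection onto $\mathcal{K}$, and $\mathbb{B}_{\delta}(z)$ the closed ball of radius $\delta$ centered at $z$. KKT mappings. $\mathcal{S}_{\rm KKT}(a,b):=\{(x,\lambda)\in\mathbb{X}\times\mathbb{Y}\mid\nabla_xL(x,\lambda)=a,\ \lambda\in\mathcal{N}_{\mathcal{K}}(g(x)-b)\}$ and $\mathcal{M}(x,a,b):=\{\lambda\in\mathbb{Y}\mid(x,\lambda)\in\mathcal{S}_{\rm KKT}(a,b)\}$. Strong calmness. $\mathcal{S}_{\rm KKT}$ has the strong calmness at the origin for $(\overline{x},\overline{\lambda})\in\mathcal{S}_{\rm KKT}(0,0)$ if there exist $\delta>0$, $\varepsilon>0$ and $\kappa>0$ such that for any $(a,b)\in\mathbb{B}_{\delta}((0,0))$ and any $(x,\lambda)\in\mathcal{S}_{\rm KKT}(a,b)\cap\mathbb{B}_{\varepsilon}((\overline{x},\overline{\lambda}))$, $$\|x-\overline{x}\|+{\rm dist}(\lambda,\mathcal{M}(\overline{x},0,0))\le\kappa\|(a,b)\|.$$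 *)

(* Defs.v *)
From HB Require Import structures.
From mathcomp Require Import all_boot all_order all_algebra.
From mathcomp Require Import sesquilinear.
From mathcomp Require Import all_classical all_reals all_analysis.
Set Implicit Arguments.
Unset Strict Implicit.
Unset Printing Implicit Defensive.
Import Order.TTheory GRing.Theory Num.Theory.
Import numFieldNormedType.Exports.
Local Open Scope classical_set_scope.
Local Open Scope ring_scope.

(* Finite dimensional real inner product spaces: finite dimension is [vectType],
   and the norm (hence the topology) is the one induced by the inner product. *)
HB.mixin Record NormedModule_Vector_isEuclidean (R : realType) E
    of NormedModule R E & Vector R E := {
  inner : {dot E for (@idfun R)} ;
  normE_inner : forall x : E, `|x| = Num.sqrt (inner x x)
}.

#[short(type="euclideanType")]
HB.structure Definition Euclidean (R : realType) :=
  {E of NormedModule R E & Vector R E & NormedModule_Vector_isEuclidean R E}.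

Notation "''[' u , v ]" := (inner u%R v%R)
  (format "''[' u ,  v ]") : ring_scope.

Section Calculus.
Variable R : realType.

(* As the spaces below are finite dimensional, continuity of the differential
   as a map into the linear maps is continuity of each x |-> 'd h x v. *)
Definition C1_on (V W : normedModType R) (U : set V) (h : V -> W) : Prop :=
  forall x, U x ->
    differentiable h x /\ forall v : V, {for x, continuous (fun y => 'd h y v)}.

Definition C2_on (V W : normedModType R) (U : set V) (h : V -> W) : Prop :=
  C1_on U h /\ forall v : V, C1_on U (fun x => 'd h x v).

(* The adjoint of 'd h x : E -> R, evaluated at 1. *)
Definition gradient (E : euclideanType R) (h : E -> R) (x : E) : E :=
  xget 0 [set v : E | forall u : E, '[v, u] = 'd h x u].

End Calculus.

Section Convex.
Variable R : realType.

Definition normal_cone (Y : euclideanType R) (K : set Y) (y : Y) : set Y :=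
  [set v | K y /\ forall z, K z -> '[v, z - y] <= 0].

(* For K nonempty, closed and convex the projection exists and is unique. *)
Definition proj (Y : euclideanType R) (K : set Y) (y : Y) : Y :=
  xget 0 [set p | K p /\ forall q, K q -> `|y - p| <= `|y - q|].

(* Only used for A nonempty; inf set0 = 0. *)
Definition dist (Y : euclideanType R) (y : Y) (A : set Y) : R :=
  inf [set `|y - a| | a in A].

Definition pointed_closed_convex_cone (Z : euclideanType R) (D : set Z) : Prop :=
  [/\ closed D, convex_set (D : set (convex_lmodType Z)),
      forall (t : R) (z : Z), 0 < t -> D z -> D (t *: z)
    & [set z | D z /\ D (- z)] = [set 0]].

Definition C2_cone_reducible (Y : euclideanType R) (K : set Y) : Prop :=
  forall ybar : Y, K ybar ->
  exists (U : set Y) (Z : euclideanType R) (D : set Z) (Xi : Y -> Z),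
    [/\ open U /\ U ybar, pointed_closed_convex_cone D, C2_on U Xi,
        Xi ybar = 0 /\ (forall z : Z, exists y : Y, 'd Xi ybar y = z)
      & K `&` U = [set y | U y /\ D (Xi y)]].

End Convex.

Section KKT.
Variables (R : realType) (X Y : euclideanType R).

(* The inner product norm of X * Y; the library's norm on X * Y is the max norm. *)
Definition pair_norm (z : X * Y) : R := Num.sqrt (`|z.1| ^+ 2 + `|z.2| ^+ 2).

Definition pair_cball (c : X * Y) (r : R) : set (X * Y) :=
  [set z | pair_norm (z - c) <= r].

Variables (f : X -> R) (g : X -> Y) (K : set Y).

Definition lagrangian (x : X) (lam : Y) : R := f x + '[lam, g x].

Definition gradx_lagrangian (x : X) (lam : Y) : X :=
  gradient (fun u => lagrangian u lam) x.

Definition S_KKT (a : X) (b : Y) : set (X * Y) :=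
  [set z | gradx_lagrangian z.1 z.2 = a /\ normal_cone K (g z.1 - b) z.2].

Definition multipliers (x : X) (a : X) (b : Y) : set Y :=
  [set lam | S_KKT a b (x, lam)].

Definition kkt_error_bound (xbar : X) (lbar : Y) : Prop :=
  exists eps c : R, [/\ 0 < eps, 0 < c &
    forall (x : X) (lam : Y), pair_cball (xbar, lbar) eps (x, lam) ->
      `|x - xbar| + dist lam (multipliers xbar 0 0)
        <= c * pair_norm (gradx_lagrangian x lam, g x - proj K (lam + g x))].

Definition strongly_calm (xbar : X) (lbar : Y) : Prop :=
  exists delta eps kappa : R, [/\ 0 < delta, 0 < eps, 0 < kappa &
    forall (a : X) (b : Y), pair_cball (0, 0) delta (a, b) ->
    forall (x : X) (lam : Y),
      (S_KKT a b `&` pair_cball (xbar, lbar) eps) (x, lam) ->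
      `|x - xbar| + dist lam (multipliers xbar 0 0) <= kappa * pair_norm (a, b)].

End KKT.

(* Main.v *)
(* The point lam lies in N_K(y) iff y = Pi_K(lam + y), and y depends on lam + y
   in a nonexpansive way.  Hence, if (x, lam) solves the KKT system perturbed
   by (a, b), its residual is at most 3 |(a, b)|.  Conversely, put
   r = g(x) - Pi_K(lam + g(x)) and mu = lam + r; then mu is in N_K(g(x) - r), so
   (x, mu) solves the KKT system perturbed by (grad_x L(x, mu), r), and this
   perturbation is bounded by a multiple of the residual at (x, lam) because the
   derivative of g is bounded near xbar. *)
From HB Require Import structures.
Require Import Defs.
From mathcomp Require Import all_boot all_order all_algebra.
From mathcomp Require Import all_classical all_reals all_analysis.
From mathcomp Require Import sesquilinear ring lra.
Import Order.TTheory GRing.Theory Num.Theory.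
Import numFieldNormedType.Exports.
Local Open Scope classical_set_scope.
Local Open Scope ring_scope.
Set Implicit Arguments.
Unset Strict Implicit.
Unset Printing Implicit Defensive.

(** * Elementary geometry of the inner product *)

Section InnerProduct.
Variables (R : realType) (E : euclideanType R).
Implicit Types u v x y : E.

Lemma innerC u v : '[u, v] = '[v, u].
Proof. by rewrite hermC /= expr0 mul1r. Qed.

Lemma innerZr (a : R) u v : '[u, a *: v] = a * '[u, v].
Proof. by rewrite linearZr_LR. Qed.

Lemma innerZl (a : R) u v : '[a *: u, v] = a * '[u, v].
Proof. by rewrite linearZl_LR. Qed.

Lemma inner_ge0 u : 0 <= '[u, u].
Proof.
have [->|u0] := eqVneq u 0; first by rewrite linear0l.
exact/ltW/neq0_dnorm_gt0.
Qed.

Lemma inner_eq0 u : '[u, u] = 0 -> u = 0.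
Proof.
by move=> uu0; apply/eqP; apply: contra_eqT uu0 => /neq0_dnorm_gt0 h; exact/lt0r_neq0/h.
Qed.

Lemma norm_sqE u : `|u| ^+ 2 = '[u, u].
Proof. by rewrite normE_inner sqr_sqrtr ?inner_ge0. Qed.

Lemma norm_sqD u v : `|u + v| ^+ 2 = `|u| ^+ 2 + 2 * '[u, v] + `|v| ^+ 2.
Proof.
rewrite !norm_sqE linearDl !linearDr /= (innerC v u); ring.
Qed.

(** Cauchy-Schwarz: expand the squared norm of [|v| u - |u| v] and divide by [|u| |v|]. *)
Lemma inner_le_norm u v : '[u, v] <= `|u| * `|v|.
Proof.
have [->|u0] := eqVneq u 0; first by rewrite linear0l normr0 mul0r.
have [->|v0] := eqVneq v 0; first by rewrite linear0r normr0 mulr0.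
have nu : 0 < `|u| by rewrite normr_gt0.
have nv : 0 < `|v| by rewrite normr_gt0.
have := sqr_ge0 `| `|v| *: u + (- `|u|) *: v|.
rewrite norm_sqD !normrZ innerZl innerZr normrN !normr_id => h.
have uv : 0 < `|u| * `|v| by rewrite mulr_gt0.
have : 0 <= (`|u| * `|v|) * (`|u| * `|v| - '[u, v]) by nra.
by rewrite pmulr_rge0 // subr_ge0.
Qed.

Lemma norm_inner_le u v : `|'[u, v]| <= `|u| * `|v|.
Proof.
rewrite ler_norml inner_le_norm andbT lerNl -[leRHS]mulrC -(normrN u) mulrC.
by rewrite -linearNl inner_le_norm.
Qed.

Lemma inner_continuous u : continuous (fun v => '[u, v]).
Proof.
apply: bounded_linear_continuous; apply/bounded_funP => r.
exists (`|u| * r) => x xr; apply: (le_trans (norm_inner_le u x)).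
by rewrite ler_wpM2l.
Qed.

Lemma inner_vbasisP u v : {in vbasis fullv, forall e : E, '[u, e] = '[v, e]} -> u = v.
Proof.
move=> uv; apply/eqP; rewrite -subr_eq0; apply/eqP/inner_eq0.
rewrite [in X in '[_, X]](coord_vbasis (memvf (u - v))) linear_sumr big1// => i _.
by rewrite linearZr_LR /= linearBl /= uv ?subrr ?mulr0 ?mem_nth ?size_tuple.
Qed.

End InnerProduct.

(** * Riesz representation, compactness of balls and existence of projections *)

Section Coordinates.
Variables (R : realType) (E : euclideanType R).
Local Notation n := (\dim {:E}).
Local Notation e := (vbasis {:E}).

(** The basis need not be orthonormal, so these are the inner products with its vectors and not the
    coordinates of [v]. *)
Definition inner_row (v : E) : 'rV[R]_n := \row_i '[v, e`_i].

Lemma inner_row_linear : linear inner_row.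
Proof.
by move=> a u v; apply/rowP => i; rewrite !mxE linearDl /= innerZl.
Qed.

HB.instance Definition _ :=
  GRing.isLinear.Build R E 'rV[R]_n _ inner_row inner_row_linear.

Lemma inner_row_inj : injective inner_row.
Proof.
move=> u v uv; apply: inner_vbasisP => w /tnthP[i ->].
by have := congr1 (fun r : 'rV__ => r 0 i) uv; rewrite !mxE (tnth_nth 0).
Qed.

(** An injective linear map between spaces of equal dimension is onto. *)
Lemma inner_row_surj (r : 'rV[R]_n) : exists v, inner_row v = r.
Proof.
have limgT : limg (linfun inner_row) = fullv.
  apply/eqP; rewrite eqEdim subvf /= limg_dim_eq.
    by rewrite !dimvf /= dim_matrix mul1r.
  apply/eqP; rewrite capfv; apply/lker0P => u v; rewrite !lfunE /=.
  exact: inner_row_inj.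
have /memv_imgP[v _ ->] : r \in limg (linfun inner_row) by rewrite limgT memvf.
by exists v; rewrite lfunE.
Qed.

Lemma riesz (l : E -> R) : scalar l -> exists v, forall u, '[v, u] = l u.
Proof.
move=> ll; have [v vl] := inner_row_surj (\row_i l e`_i).
exists v => u.
have l0 : l 0 = 0 by have := ll (-1) 0 0; rewrite scaler0 addr0 mulN1r addNr.
rewrite (coord_vbasis (memvf u)) linear_sumr.
apply: (big_rec2 (fun x y => x = l y)) => // i x y _ ->.
rewrite ll linearZr_LR /=; congr (_ * _ + _).
by have := congr1 (fun r : 'rV__ => r 0 i) vl; rewrite !mxE.
Qed.

(** By Riesz each coordinate is the inner product with a fixed vector, so Cauchy-Schwarz bounds it;
    the sum of the norms of these vectors serves all [i] at once. *)
Lemma coord_vbasis_bounded :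
  exists2 C : R, 0 <= C & forall (i : 'I_n) (u : E), `|coord e i u| <= C * `|u|.
Proof.
have /choice[v vE] (i : 'I_n) : exists v, forall u, '[v, u] = coord e i u.
  by apply: riesz; exact: linearP.
exists (\sum_i `|v i|); first exact: sumr_ge0.
move=> i u; rewrite -vE (le_trans (norm_inner_le _ _))// ler_wpM2r//.
by rewrite (bigD1 i)//= lerDl sumr_ge0.
Qed.

(** Bounded coordinates place the ball, which is closed, inside the image of a compact box under the
    continuous map [G]. *)
Lemma closed_ball0_compact (r : R) : compact [set u : E | `|u| <= r].
Proof.
have [C C0 coordC] := coord_vbasis_bounded.
pose G (c : 'rV[R]_n) : E := \sum_i c 0 i *: e`_i.
have Gcont : continuous G.
  apply: continuous_big => [|i _ c]; first exact: add_continuous.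
  have /cvgZr_tmp := @coord_continuous R 1 n 0 i c.
  by apply; exact: nbhs_filter.
have box_compact : compact [set c : 'rV[R]_n | forall i, `[- (C * r), C * r]%classic (c 0 i)].
  by apply: (@rV_compact _ _ (fun=> `[- (C * r), C * r]%classic)) => i; exact: segment_compact.
have ball_closed : closed [set u : E | `|u| <= r].
  apply: (@closed_comp _ _ (fun u : E => `|u|) [set t | t <= r]); last exact: closed_le.
  by move=> u _; exact: norm_continuous.
apply: subclosed_compact ball_closed
  (continuous_compact (continuous_subspaceT Gcont) box_compact) _.
move=> u /= ur; exists (\row_i coord e i u).
  move=> i; rewrite mxE /= in_itv /= -ler_norml (le_trans (coordC _ _))//.
  by rewrite ler_wpM2l.
rewrite [RHS](coord_vbasis (memvf u)); apply: eq_bigr => i _.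
by rewrite mxE.
Qed.

Lemma proj_exists (K : set E) (y : E) : K !=set0 -> closed K ->
  K (Defs.proj K y) /\ forall q, K q -> `|y - Defs.proj K y| <= `|y - q|.
Proof.
move=> [q0 Kq0] Kcl.
(* With this radius [A] contains [q0], and any point of [K] outside [A] is farther from [y] than
   [q0] is. *)
set A := [set u : E | `|u| <= `|y| + `|y - q0|] `&` K.
have Acompact : compact A by exact/compact_closedI/Kcl/closed_ball0_compact.
have A0 : A !=set0.
  by exists q0; split => //=; rewrite -{1}[q0](subKr y) ler_normB.
have fcont : {within A, continuous (fun u : E => `|y - u|)}.
  apply: continuous_subspaceT => u; apply: cvg_norm; apply: cvgB; [exact: cvg_cst|exact: cvg_id].
have [p /set_mem[_ Kp] pmin] := compact_EVT_min A0 Acompact fcont.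
suff : [set p | K p /\ forall q, K q -> `|y - p| <= `|y - q|] (Defs.proj K y) by [].
apply: xgetPex; exists p; split => // q Kq.
have [qA|qA] := leP `|q| (`|y| + `|y - q0|); first by apply: pmin; rewrite inE.
have q0A : `|y - p| <= `|y - q0|.
  by apply: pmin; rewrite inE; split => //=; rewrite -{1}[q0](subKr y) ler_normB.
apply: (le_trans q0A); move: qA.
rewrite -{1}[q](subKr y) => /ltW /le_trans /(_ (ler_normB _ _)).
by rewrite lerD2l.
Qed.

End Coordinates.

(** * Normal cone and projection *)

Section NormalCone.
Variables (R : realType) (Y : euclideanType R) (K : set Y).

(** Monotonicity of the normal cone, ['[v - w, p - q] >= 0], followed by Cauchy-Schwarz. Here [p]
    and [q] act as the projections of [p + v] and [q + w]. *)
Lemma normal_cone_nonexpansive (p q v w : Y) :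
  normal_cone K p v -> normal_cone K q w -> `|p - q| <= `|p + v - (q + w)|.
Proof.
move=> [Kp pv] [Kq qw].
have h1 := pv q Kq; have h2 := qw p Kp.
have h3 : `|p - q| ^+ 2 <= '[p + v - (q + w), p - q].
  have -> : p + v - (q + w) = (p - q) + (v - w) by rewrite opprD addrACA.
  rewrite linearDl /= -norm_sqE lerDl linearBl /= subr_ge0.
  by move: h1; rewrite -opprB linearNr /= oppr_le0; apply: le_trans.
have := le_trans h3 (inner_le_norm _ _).
have [->//|pq] := eqVneq `|p - q| 0.
by rewrite expr2 ler_pM2r // lt_def pq /=.
Qed.

Hypotheses (K_nonempty : K !=set0) (K_closed : closed K).
Hypothesis K_convex : convex_set (K : set (convex_lmodType Y)).

Lemma normal_cone_proj (y : Y) :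
  normal_cone K (Defs.proj K y) (y - Defs.proj K y).
Proof.
have [Kp pmin] := proj_exists y K_nonempty K_closed.
set p := Defs.proj K y in Kp pmin *; split => // z Kz.
rewrite leNgt; apply/negP => ip.
have zp : 0 < `|z - p|.
  by rewrite normr_gt0; apply: contraTneq ip => ->; rewrite linear0r ltxx.
(* Moving from [p] to [p + t (z - p)] with this [t] would decrease the distance to [y]. *)
pose t : R := Num.min 1 ('[y - p, z - p] / `|z - p| ^+ 2).
have t0 : 0 < t by rewrite /t lt_min ltr01 divr_gt0 ?exprn_gt0.
have t1 : t <= 1 by rewrite /t ge_min lexx.
have tz : t * `|z - p| ^+ 2 <= '[y - p, z - p].
  by rewrite -ler_pdivlMr ?exprn_gt0// /t ge_min lexx orbT.
have Kq : K (p + t *: (z - p)).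
  have := K_convex (Itv01 (ltW t0) t1) (mem_set Kz) (mem_set Kp).
  rewrite inE; congr (K _).
  by rewrite /conv /= scalerBl scale1r scalerBr addrCA.
have := pmin _ Kq.
rewrite -ler_sqr ?nnegrE// opprD addrA (norm_sqD (y - p)) normrN normrZ (gtr0_norm t0).
rewrite linearNr linearZr_LR /= => le_sq.
(* By [tz] the quadratic term in [le_sq] is at most [t * '[y - p, z - p]], half of the linear
   decrease. *)
suff : 0 < t * '[y - p, z - p] by nra.
exact: mulr_gt0.
Qed.

End NormalCone.

(** * Distance to a set *)

Section Dist.
Variables (R : realType) (Y : euclideanType R).

Lemma dist_le (y a : Y) (A : set Y) : A a -> dist y A <= `|y - a|.
Proof.
move=> Aa; apply: ge_inf; last by exists a.
by exists 0 => _ [b _ <-]; exact: normr_ge0.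
Qed.

Lemma dist_triangle (y z : Y) (A : set Y) :
  A !=set0 -> dist y A <= `|y - z| + dist z A.
Proof.
move=> [a0 Aa0]; rewrite -lerBlDl; apply: lb_le_inf; first by exists `|z - a0|, a0.
move=> _ [a Aa <-]; rewrite lerBlDl (le_trans (dist_le y Aa))//.
by rewrite -(subrKA z) ler_normD.
Qed.

End Dist.

(** * The product norm against the norms of the components *)

Section PairNorm.
Variables (R : realType) (X Y : euclideanType R).
Implicit Type z : X * Y.

Lemma norm_fst_le z : `|z.1| <= pair_norm z.
Proof.
rewrite -[leLHS]normr_id -sqrtr_sqr.
by rewrite ler_wsqrtr// lerDl sqr_ge0.
Qed.

Lemma norm_snd_le z : `|z.2| <= pair_norm z.
Proof.
rewrite -[leLHS]normr_id -sqrtr_sqr.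
by rewrite ler_wsqrtr// lerDr sqr_ge0.
Qed.

Lemma pair_norm_le z : pair_norm z <= `|z.1| + `|z.2|.
Proof.
rewrite -[leRHS]ger0_norm ?addr_ge0// -sqrtr_sqr ler_wsqrtr// sqrrD.
by rewrite -addrA [_ *+ 2 + _]addrC addrA lerDl mulrn_wge0// mulr_ge0.
Qed.

End PairNorm.

(** * The gradient of the Lagrangian and local bounds on the derivative of the constraint map *)

Section Gradient.
Variables (R : realType) (X Y : euclideanType R).

(** Riesz supplies a representing vector, so [xget] does not fall back on its default 0. *)
Lemma gradientE (h : X -> R) (x u : X) : '[gradient h x, u] = 'd h x u.
Proof.
suff : [set v : X | forall u, '[v, u] = 'd h x u] (gradient h x) by exact.
by apply: xgetPex; apply: riesz; exact: linearP.
Qed.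

Lemma diff_lagrangian (f : X -> R) (g : X -> Y) (lam : Y) (x u : X) :
  differentiable f x -> differentiable g x ->
  'd (fun x => lagrangian f g x lam) x u = 'd f x u + '[lam, 'd g x u].
Proof.
move=> df dg.
have dlam : 'd (inner lam : Y -> R) (g x) = inner lam :> (Y -> R).
  by apply: diff_lin; exact: inner_continuous.
have diff_lam : differentiable (inner lam : Y -> R) (g x).
  by apply: linear_differentiable; exact: inner_continuous.
have di : differentiable (inner lam \o g) x by apply: differentiable_comp.
have -> : (fun x => lagrangian f g x lam) = f + (inner lam \o g) by [].
apply: etrans (congr1 (fun F : X -> R => F u) (diffD df di)) _.
have dcomp := congr1 (fun F : X -> R => F u) (diff_comp dg diff_lam).
apply: (congr1 (+%R ('d f x u))); apply: etrans dcomp _.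
by rewrite /= dlam.
Qed.

Lemma inner_gradx_lagrangian (f : X -> R) (g : X -> Y) (lam : Y) (x u : X) :
  differentiable f x -> differentiable g x ->
  '[gradx_lagrangian f g x lam, u] = 'd f x u + '[lam, 'd g x u].
Proof.
move=> df dg; apply: etrans (diff_lagrangian lam u df dg).
exact: gradientE.
Qed.

(** The difference [w] of the gradients is the adjoint of ['d g x] applied to [lam - mu]; testing
    this against [w] itself gives the bound. *)
Lemma gradx_lagrangian_lipschitz (f : X -> R) (g : X -> Y) (x : X) (M : R) (lam mu : Y) :
  0 <= M -> differentiable f x -> differentiable g x ->
  (forall u, `|'d g x u| <= M * `|u|) ->
  `|gradx_lagrangian f g x lam - gradx_lagrangian f g x mu| <= M * `|lam - mu|.
Proof.
move=> M0 df dg gM; set w := (X in `|X|).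
have winner u : '[w, u] = '[lam - mu, 'd g x u].
  rewrite linearBl.
  apply: etrans (congr2 _ (inner_gradx_lagrangian lam u df dg)
                          (congr1 _ (inner_gradx_lagrangian mu u df dg))) _.
  by rewrite linearBl /= opprD addrACA subrr add0r.
move: w winner => w winner.
have : `|w| ^+ 2 <= M * `|lam - mu| * `|w|.
  rewrite norm_sqE winner (le_trans (inner_le_norm _ _))//.
  by rewrite -mulrA mulrCA ler_wpM2l.
have [->|w0] := eqVneq `|w| 0; first by rewrite mulr_ge0.
by rewrite expr2 ler_pM2r// lt_def w0 /=.
Qed.

(** Continuity bounds the images of the finitely many basis vectors near [x0]; expanding [u] in the
    basis makes the bound uniform in [u]. *)
Lemma diff_bounded_near (g : X -> Y) (x0 : X) : C1_on setT g ->
  exists M rho : R, [/\ 0 <= M, 0 < rho & forall x : X, `|x - x0| <= rho ->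
    forall u, `|'d g x u| <= M * `|u|].
Proof.
move=> gC1.
have [C C0 coordC] := coord_vbasis_bounded X.
pose e := vbasis {:X}.
pose m i := `|'d g x0 e`_i| + 1.
have near_m : \forall x \near x0, forall i : 'I_(\dim {:X}), `|'d g x e`_i| <= m i.
  apply: filter_forall => i.
  have /= dgc := (gC1 x0 I).2 e`_i.
  have /= := @cvgr_norm_le _ _ _ _ _ _ _ dgc (m i).
  by apply; rewrite /m ltrDl.
have /nbhs_normP[rho /= rho0 rhoP] := near_m.
(* Halving [rho] fits the closed ball into the open one. *)
exists (C * \sum_(i < \dim {:X}) m i), (rho / 2); split.
- by rewrite mulr_ge0// sumr_ge0// => i _; rewrite addr_ge0.
- by rewrite divr_gt0.
move=> x xrho u.
have {}rhoP : forall i : 'I_(\dim {:X}), `|'d g x e`_i| <= m i.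
  apply: rhoP; rewrite /= distrC (le_lt_trans xrho)// ltr_pdivrMr//.
  by rewrite ltr_pMr// ltr1n.
rewrite {1}(coord_vbasis (memvf u)) linear_sum /= (le_trans (ler_norm_sum _ _ _))//.
rewrite mulr_sumr mulr_suml ler_sum// => i _.
by rewrite linearZ normrZ mulrAC ler_pM.
Qed.

End Gradient.

Theorem theorem3p1 (R : realType) (X Y : euclideanType R)
    (f : X -> R) (g : X -> Y) (K : set Y) (xbar : X) (lbar : Y)
    (f_C2 : C2_on setT f) (g_C2 : C2_on setT g)
    (K_nonempty : K !=set0) (K_closed : closed K)
    (K_convex : convex_set (K : set (convex_lmodType Y)))
    (K_reducible : C2_cone_reducible K)
    (kkt_bar : S_KKT f g K 0 0 (xbar, lbar)) :
  kkt_error_bound f g K xbar lbar <-> strongly_calm f g K xbar lbar.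
Proof.
have lbar_mult : multipliers f g K xbar 0 0 lbar by [].
have normal_proj := normal_cone_proj K_nonempty K_closed K_convex.
split=> [[eps [c [eps0 c0 error_bound]]]|[delta [eps [kappa [delta0 eps0 kappa0 calm]]]]].
  (* The size of [(a, b)] is unrestricted here, so 1 is an arbitrary choice. The factor 3 comes from
     bounding the residual by [|a| + 2 |b|]. *)
  exists 1, eps, (c * 3); split; rewrite ?mulr_gt0// => a b _ x lam [[/= gradL lamN] near_bar].
  apply: (le_trans (error_bound _ _ near_bar)).
  rewrite gradL -mulrA ler_pM2l// (le_trans (pair_norm_le _))//=.
  (* The two points plus their normals are [g x - b + lam] and [lam + g x], which differ by [b]
     only. *)
  have projK := normal_cone_nonexpansive lamN (normal_proj (lam + g x)).
  have resid : `|g x - Defs.proj K (lam + g x)| <= 2 * `|b|.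
    move: projK; set q := Defs.proj _ _; clearbody q.
    have -> : g x - b + lam - (q + (lam + g x - q)) = - b.
      by rewrite subrKC [_ + lam]addrC opprD addrACA subrr add0r addrAC subrr add0r.
    rewrite normrN => projK.
    have -> : g x - q = b + (g x - b - q) by rewrite addrA subrKC.
    by rewrite (le_trans (ler_normD _ _))// mulr_natl mulr2n lerD2l.
  have := norm_fst_le (a, b); have := norm_snd_le (a, b) => /=; lra.
have [M [rho [M0 rho0 diff_bound]]] := diff_bounded_near xbar g_C2.1.
(* For residuals up to [eta], the first bound keeps the corrected multiplier within reach of [lbar],
   and the second keeps the perturbation in the [delta] ball. *)
pose eta := Num.min (eps / 4) (delta / (2 + M)).
have M2 : 0 < 2 + M by rewrite ltr_wpDr.
have eta0 : 0 < eta by rewrite lt_min !divr_gt0.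
have eta_eps : eta <= eps / 4 by rewrite ge_min lexx.
have eta_delta : (2 + M) * eta <= delta by rewrite mulrC -ler_pdivlMr// ge_min lexx orbT.
(* The three summands pay for calmness at the corrected multiplier, for the return from it to [lam],
   and for residuals above [eta]. *)
exists (Num.min (eps / 4) rho), (kappa * (2 + M) + 1 + eps / 2 / eta); split.
- by rewrite lt_min divr_gt0.
- by rewrite addr_gt0 ?divr_gt0// addr_gt0// mulr_gt0.
move=> x lam near_bar.
have : `|x - xbar| <= Num.min (eps / 4) rho := le_trans (norm_fst_le _) near_bar.
rewrite le_min => /andP[x_eps x_rho].
have : `|lam - lbar| <= Num.min (eps / 4) rho := le_trans (norm_snd_le _) near_bar.
rewrite le_min => /andP[lam_eps _].
set r := g x - _; set T := pair_norm _.
have gradT : `|gradx_lagrangian f g x lam| <= T := norm_fst_le (_, r).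
have rT : `|r| <= T := norm_snd_le (_, r).
have T0 : 0 <= T := le_trans (normr_ge0 _) rT.
have dist_bar := dist_le lam lbar_mult.
(* A residual bounded below needs no calmness: the left side is at most eps / 2. *)
have [T_eta|eta_T] := leP T eta; last first.
  have : eps / 2 <= eps / 2 / eta * T.
    by rewrite mulrAC ler_pdivlMr// ler_wpM2l ?divr_ge0// ltW.
  have : 0 <= (kappa * (2 + M) + 1) * T.
    by rewrite mulr_ge0// addr_ge0// mulr_ge0// ltW.
  lra.
pose mu := lam + r.
have mu_normal : normal_cone K (g x - r) mu.
  have := normal_proj (lam + g x).
  by rewrite /mu /r subKr addrA.
(* Passing from [lam] to [mu] changes the gradient by at most [M * |r|]. *)
have [gmu kkt_mu grad_mu] : exists2 gmu, S_KKT f g K gmu r (x, mu) & `|gmu| <= T + M * T.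
  exists (gradx_lagrangian f g x mu) => //.
  have := gradx_lagrangian_lipschitz mu lam M0 (f_C2.1 x I).1 (g_C2.1 x I).1 (diff_bound x x_rho).
  rewrite /mu (addrC lam r) addrK -/mu => lip.
  have := le_trans (lerB_dist _ _) lip.
  rewrite lerBlDl => /le_trans; apply; apply: lerD gradT _.
  exact: ler_wpM2l M0 _ _ rT.
(* Otherwise unification unfolds the gradient and the projection. *)
clearbody r T.
have pairT : pair_norm (gmu, r) <= (2 + M) * T.
  rewrite (le_trans (pair_norm_le _))//=; lra.
have near_delta : pair_cball (0, 0) delta (gmu, r).
  rewrite /pair_cball /= -[X in X <= _]/(pair_norm (_ - 0, _ - 0)) !subr0.
  by rewrite (le_trans pairT)// (le_trans _ eta_delta)// ler_pM2l.
have near_eps : pair_cball (xbar, lbar) eps (x, mu).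
  rewrite /pair_cball /= (le_trans (pair_norm_le _))//=.
  have : `|mu - lbar| <= `|lam - lbar| + `|r| by rewrite /mu addrAC ler_normD.
  (* The three contributions [|x - xbar|], [|lam - lbar|] and [|r|] are at most [eps / 4] each. *)
  lra.
have := calm _ _ near_delta x mu (conj kkt_mu near_eps).
have := @dist_triangle _ _ lam mu _ (ex_intro _ lbar lbar_mult).
rewrite {1}/mu opprD addNKr normrN => dist_mu calm_mu.
have : kappa * pair_norm (gmu, r) <= kappa * ((2 + M) * T).
  by rewrite ler_pM2l.
have : 0 <= eps / 2 / eta * T by rewrite mulr_ge0// !divr_ge0// ltW.
lra.
Qed.
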